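(* Let $(X_i)_{i\ge 1}$ be independent identically distributed exponential random variables with mean $1$ (the individual claims). Fix $\alpha\in(0,1)$ and $\theta>0$, and set $c=1+\theta$. For $u\in\mathbb{R}$ (the initial capital) let $U_n=u+cn-(X_1+\cdots+X_n)$ for $n\in\mathbb{N}^+$, and let $$\psi(u):=\Pr(U_n<0\ \text{ for some } n\in\mathbb{N}^+)$$ be the ruin probability. Then: (a) The ruin probability is given by $$\psi(u)=\begin{cases}\dfrac{t(c)}{c}\exp\left(-u\left(1-\dfrac{t(c)}{c}\right)\right), & \text{if } u>-c,\\[2mm] 1, & \text{if } u\le -c,\end{cases}$$ where $t$ is the function defined in the context. (b) The minimum initial capital $u=u(\alpha,\theta)$ needed to ensure that $\psi(u)\le\alpha$ is given by the unique root of the equation $$(1+\theta+u)\left(1-\alpha^{\frac{1+\theta}{1+\theta+u}}\right)=-\log\alpha,\qquad u>-(1+\theta).$$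
   Context: $\mathbb{N}^+=\{1,2,3,\ldots\}$ and $\log$ is the natural logarithm. The function $g(x)=xe^{-x}$ maps $[0,1]$ bijectively (and increasingly) onto $[0,e^{-1}]$; let $g_r$ denote its restriction to $[0,1]$. For $x\ge 0$ define $t(x):=g_r^{-1}(xe^{-x})=\sum_{k=1}^\infty \frac{k^{k-1}}{k!}(xe^{-x})^k$. That is, $t(x)$ is the unique element of $[0,1]$ with $t(x)e^{-t(x)}=xe^{-x}$; in particular $t(x)=x$ for $x\in[0,1]$, and $t(x)\in(0,1]$ for $x\ge 1$. The ''minimum initial capital needed to ensure that $\psi(u)\le\alpha$'' means the smallest real number $u$ with $\psi(u)\le\alpha$. *)

(* Defs.v *)
From mathcomp Require Import all_boot all_order all_algebra.
From mathcomp Require Import finmap ring.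
From mathcomp Require Import all_classical all_reals all_analysis.
Set Implicit Arguments.
Unset Strict Implicit.
Unset Printing Implicit Defensive.
Import Order.TTheory GRing.Theory Num.Theory.
Import numFieldNormedType.Exports.
Local Open Scope classical_set_scope.
Local Open Scope ring_scope.

Definition gfun (R : realType) (x : R) : R := x * expR (- x).

(* The pseudo-inverse [pinv A f] is the inverse of the restriction of [f] to
   [A] on the image [f @` A], and a junk value elsewhere; by [gfun_bij] below,
   [gfun x] lies in this image for every [x >= 0]. *)
Definition tfun (R : realType) (x : R) : R := pinv (`[0, 1] : set R) (@gfun R) (gfun x).

Section tfun_theory.
Variable R : realType.
Implicit Types x y : R.

Lemma gfun_incr x y : 0 <= x -> x < y -> y <= 1 -> gfun x < gfun y.
Proof.
move=> x0 xy y1; rewrite /gfun.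
have -> : - y = - x + (x - y) by rewrite addrA addNr add0r.
rewrite expRD mulrCA [ltLHS]mulrC ltr_pM2l ?expR_gt0//.
have h : 1 + (x - y) < expR (x - y) by apply: expR_gt1Dx; rewrite subr_eq0 lt_eqF.
apply: (@le_lt_trans _ _ (y * (1 + (x - y)))); last first.
  by rewrite ltr_pM2l// (le_lt_trans x0).
rewrite -subr_ge0.
have -> : y * (1 + (x - y)) - x = (y - x) * (1 - y).
  by ring.
by rewrite mulr_ge0// subr_ge0// ltW.
Qed.

Lemma gfun_le x : gfun x <= expR (-1).
Proof.
rewrite /gfun -ler_pdivlMr ?expR_gt0// -expRN opprK -expRD.
by have := expR_ge1Dx (-1 + x); rewrite addrA addrN add0r.
Qed.

Lemma gfun_bij : set_bij (`[0, 1] : set R) `[0, expR (-1)] (@gfun R).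
Proof.
split.
- move=> x /=; rewrite !in_itv/= => /andP[x0 x1].
  by rewrite gfun_le mulr_ge0// expR_ge0.
- move=> x y; rewrite !inE/= !in_itv/= => /andP[x0 x1] /andP[y0 y1] gxy.
  case: (ltgtP x y) => // [xy|yx].
  + by have := gfun_incr x0 xy y1; rewrite gxy ltxx.
  + by have := gfun_incr y0 yx x1; rewrite gxy ltxx.
- move=> y /=; rewrite in_itv/= => /andP[y0 y1].
  have [|||x x01 gx] := @IVT R (@gfun R) 0 1 y; [exact: ler01| | |by exists x].
  + apply: continuous_subspaceT => x; apply: cvgM; first exact: cvg_id.
    by apply: continuous_comp; [exact: opp_continuous|exact: continuous_expR].
  + rewrite /gfun mul0r mul1r.
    by rewrite min_l ?expR_ge0// max_r ?expR_ge0// y0.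
Qed.

Lemma tfun_spec x : 0 <= x ->
  [/\ 0 <= tfun x <= 1, gfun (tfun x) = gfun x &
      forall y, 0 <= y <= 1 -> gfun y = gfun x -> y = tfun x].
Proof.
move=> x0; have [_ ginj gsurj] := gfun_bij.
have : `[0, expR (-1)]%classic (gfun x).
  by rewrite /= in_itv/= gfun_le mulr_ge0 ?expR_ge0.
move=> /gsurj[z z01 gz].
have tz : tfun x = z by rewrite /tfun -gz pinvKV ?inE.
rewrite tz; split=> [||y y01 gy].
- exact: z01.
- exact: gz.
- by apply: ginj; rewrite ?inE//= ?in_itv// gz.
Qed.

End tfun_theory.

Section mutual_independence.
Context d (T : measurableType d) (R : realType) (P : probability T R).

Definition mutually_independent (X : nat -> {RV P >-> R}) : Prop :=
  forall (J : {fset nat}) (B : nat -> set R),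
    (forall i, measurable (B i)) ->
    P (\bigcap_(i in [set` J]) X i @^-1` B i) =
      (\prod_(i <- J) P (X i @^-1` B i))%E.

(* Equality is only required on measurable sets: elsewhere both sides are
   unspecified. The parameter of [exponential_prob] is the rate, i.e. the
   inverse of the mean. *)
Definition exponential_with_mean (m : R) (X : {RV P >-> R}) : Prop :=
  forall B : set R, measurable B -> distribution P X B = exponential_prob m^-1 B.

(* Indices are shifted: the claims X_1, X_2, ... are [X 0], [X 1], ... *)
Definition surplus (c u : R) (X : nat -> {RV P >-> R}) (n : nat) (w : T) : R :=
  u + c * n%:R - \sum_(i < n) X i w.

Definition ruin_probability (c : R) (X : nat -> {RV P >-> R}) (u : R) : \bar R :=
  P [set w | exists2 n, (0 < n)%N & surplus c u X n w < 0].

End mutual_independence.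

Definition is_minimum (R : realType) (A : set R) (m : R) : Prop :=
  A m /\ lbound A m.

(* Main.v *)
(* Let [Z n = u + c (n + 1) - (X_1 + ... + X_n)], so that ruin at time [n + 1]
   means [X_(n+1) > Z n]. Conditioning on the first [n] claims shows that
   [M_g n = E (exp (- g (Z n)); no ruin up to time n)] satisfies
   [M_g (n+1) = K g (M_g n - M_1 n)] with [K g = exp (- g c) / (1 - g)].
   Both [g = 0] and [g = r := 1 - t(c)/c] have [K g = 1], hence
   [P (no ruin up to time n) - M_r n = M_0 n - M_r n] does not depend on [n]
   and equals [1 - exp (- r (u + c))]. Moreover [K g < 1] at the minimiser
   [g = 1 - 1/c <= r] of [K], so that [M_r n <= M_g n <= (K g)^n] vanishes,
   which gives [psi u = exp (- r (u + c))] for [u >= - c]. For the second part, a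
   root [u] of the equation makes [x = c + c ln alpha / (c + u) < c] satisfy
   [x exp (- x) = c exp (- c)], which forces [x = t(c)]. *)
Require Import Defs.
From HB Require Import structures.
From mathcomp Require Import all_boot all_order all_algebra.
From mathcomp Require Import finmap ring.
From mathcomp Require Import all_classical all_reals all_analysis.
From mathcomp Require Import measurable_realfun.
Import Order.TTheory GRing.Theory Num.Theory.
Import numFieldNormedType.Exports.
Local Open Scope classical_set_scope.
Set Implicit Arguments.
Unset Strict Implicit.
Local Open Scope ring_scope.

(** * Integration against densities, and joint laws of independent variables *)

Section density.
Local Open Scope ereal_scope.
Context d (T : measurableType d) (R : realType).
Variables (mu : {sigma_finite_measure set T -> \bar R})
  (nu : {finite_measure set T -> \bar R}) (f : T -> R).
Hypotheses (mf : measurable_fun setT f)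
  (nuE : forall A, measurable A -> nu A = \int[mu]_(x in A) (f x)%:E).

Lemma density_dominates : nu `<< mu.
Proof.
apply/null_content_dominatesP => A mA muA0; rewrite nuE// null_set_integral//.
exact/measurable_EFinP/measurable_funTS.
Qed.

(** By [nuE], [f] has the same integrals as the Radon-Nikodym derivative of [nu], hence equals it
    almost everywhere; the change of variables for that derivative then applies. *)
Lemma integral_density (g : T -> \bar R) (E : set T) : measurable E ->
  nu.-integrable E g ->
  \int[nu]_(x in E) g x = \int[mu]_(x in E) (g x * (f x)%:E).
Proof.
move=> mE intg; have mg := measurable_int _ intg.
rewrite -(Radon_Nikodym_change_of_variables density_dominates)//.
have mf' A : measurable_fun A (EFin \o f) by exact/measurable_EFinP/measurable_funTS.
apply: ae_eq_integral => //.
- apply: emeasurable_funM => //; apply: (measurable_int mu).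
  apply: (integrableS _ _ (@subsetT _ _)) => //=.
  by apply: Radon_Nikodym_integrable; exact: density_dominates.
- by apply: emeasurable_funM => //; exact: mf'.
- apply: ae_eqe_mul2l; apply: integral_ae_eq => //=.
  + apply: (integrableS _ _ (@subsetT _ _)) => //=.
    by apply: Radon_Nikodym_integrable; exact: density_dominates.
  + move=> A AE mA; rewrite -Radon_Nikodym_integral//; first exact: nuE.
    exact: density_dominates.
Qed.

End density.

Lemma integral_exponential_expR (R : realType)
    (nu : {finite_measure set (measurableTypeR R) -> \bar R}) (a w : R) :
    (forall A, measurable A -> nu A = exponential_prob 1 A) ->
    0 <= a < 1 -> 0 <= w ->
  (\int[nu]_(x in `]-oo, w]) (expR (a * x))%:E
   = ((1 - expR ((a - 1) * w)) / (1 - a))%:E)%E.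
Proof.
move=> nuE /andP[a0 a1] w0.
have mexp A : measurable_fun A (fun x : R => expR (a * x)).
  by apply: measurableT_comp => //; exact: measurable_funM.
rewrite (@integral_density _ _ R (@lebesgue_measure R) nu (exponential_pdf 1))//; last 2 first.
- exact: measurable_exponential_pdf.
- apply: measurable_bounded_integrable => //.
  + by rewrite ltey_eq fin_num_measure.
  + exact: mexp.
  + exists (expR (a * w)); split; first exact: num_real.
    move=> M wM x /=; rewrite in_itv/= => xw.
    rewrite ger0_norm ?expR_ge0// (le_trans _ (ltW wM))// ler_expR.
    exact: ler_wpM2l.
rewrite (_ : (fun x => _)%E =
    (fun x : R => (expR ((a - 1) * x))%:E) \_ `[0, +oo[); last first.
  apply/funext => x; rewrite /exponential_pdf !patchE.
  case: ifPn => _; last by rewrite mule0.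
  by rewrite -EFinM mul1r -expRD; congr (expR _)%:E; ring.
rewrite -integral_mkcondr (_ : _ `&` _ = `[0, w]%classic); last first.
  apply/seteqP; split => x /=; rewrite !in_itv/= ?andbT.
    by move=> [-> ->].
  by move=> /andP[-> ->].
(* The fundamental theorem of calculus needs a nondegenerate interval, so [w = 0] is treated
   apart. *)
move: w0; rewrite le_eqVlt => /predU1P[<-|w0].
  by rewrite set_itv1 integral_set1 mulr0 expR0 subrr mul0r.
have a10 : a - 1 != 0 by rewrite subr_eq0 lt_eqF.
have cexp : continuous (fun x : R => expR ((a - 1) * x)).
  move=> x; apply: continuous_comp; last exact: continuous_expR.
  by apply: continuousM => //; exact: cst_continuous.
rewrite (@continuous_FTC2 _ _ (fun x => expR ((a - 1) * x) / (a - 1)))//.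
- rewrite -EFinB mulr0 expR0; congr (_%:E); field; by rewrite a10 subr_eq0 gt_eqF.
- exact: continuous_subspaceT.
- split.
  + by move=> z _; exact: ex_derive.
  + apply/cvg_at_right_filter; apply: cvgMl; exact: cexp.
  + apply/cvg_at_left_filter; apply: cvgMl; exact: cexp.
- move=> z _; rewrite derive1E derive_val !scaler0 add0r /GRing.scale/= mulr1.
  by rewrite mulrCA mulVf// mulr1.
Qed.

(** Independence identifies the joint law with the product of the two laws, to which Tonelli
    applies. *)
Lemma ge0_integral_independent d d1 d2 (T : measurableType d)
    (T1 : measurableType d1) (T2 : measurableType d2) (R : realType)
    (P : probability T R) (Z : {mfun T >-> T1}) (Y : {mfun T >-> T2})
    (F : T1 * T2 -> \bar R) :
  (forall A B, measurable A -> measurable B ->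
    P (Z @^-1` A `&` Y @^-1` B) = P (Z @^-1` A) * P (Y @^-1` B))%E ->
  measurable_fun setT F -> (forall z, 0 <= F z)%E ->
  (\int[P]_w F (Z w, Y w) = \int[P]_w \int[distribution P Y]_y F (Z w, y))%E.
Proof.
move=> ZY mF F0.
have mZY : measurable_fun setT (fun w => (Z w, Y w)).
  exact: measurable_fun_pair.
have -> : (\int[P]_w F (Z w, Y w) = \int[pushforward P (fun w => (Z w, Y w))]_z F z)%E.
  by rewrite ge0_integral_pushforward.
transitivity (\int[distribution P Z \x distribution P Y]_z F z)%E.
  apply: eq_measure_integral => A mA _.
  apply/esym/product_measure_unique => //.
apply: etrans; first exact: fubini_tonelli1.
rewrite ge0_integral_distribution//.
- exact: measurable_fun_fubini_tonelli_F.
- by move=> z; apply: integral_ge0.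
Qed.

(** * Independence of a claim from the sigma-algebra of other claims *)

Section independent_sigma_algebra.
Context d (T : measurableType d) (R : realType) (P : probability T R).
Variables (X : nat -> {RV P >-> R}) (J : {fset nat}).

(** A pi-system generating the sigma-algebra of the [X i] with [i] in [J]. *)
Definition cylinders : set (set T) :=
  [set \bigcap_(i in [set` J]) X i @^-1` B i | B in
    [set B : nat -> set R | forall i, measurable (B i)]].

Lemma cylinders_measurable : cylinders `<=` measurable.
Proof.
move=> _ [B mB <-]; apply: fin_bigcap_measurable => // i _.
by rewrite -[X in measurable X]setTI; exact: measurable_funP.
Qed.

Lemma sigma_cylinders_measurable : <<s cylinders >> `<=` measurable.
Proof.
apply: smallest_sub; first exact: sigma_algebra_measurable.
exact: cylinders_measurable.
Qed.

Lemma measurable_fun_id_cylinders :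
  measurable_fun setT (id : T -> g_sigma_algebraType cylinders).
Proof. by move=> _ A mA; rewrite setTI; exact: sigma_cylinders_measurable. Qed.

Lemma measurable_fun_cylinders i : i \in J ->
  measurable_fun setT (X i : g_sigma_algebraType cylinders -> R).
Proof.
move=> iJ _ B mB; rewrite setTI; apply: sub_sigma_algebra.
exists (fun j => if j == i then B else setT) => [j|].
  by case: ifP.
apply/seteqP; split=> [w|w XwB j _] /=; first by move=> /(_ i iJ); rewrite eqxx.
by case: eqP => // ->.
Qed.

(** As functions of [A], both sides are finite measures, so it suffices that they agree on the
    pi-system of cylinders. There, mutual independence is applied to [J] with [k] added. *)
Lemma sigma_cylinders_independent k A B : mutually_independent X -> k \notin J ->
  <<s cylinders >> A -> measurable B ->
  (P (A `&` X k @^-1` B) = P A * P (X k @^-1` B))%E.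
Proof.
move=> Xind kJ sA mB.
have mXB : measurable (X k @^-1` B).
  by rewrite -[X in measurable X]setTI; exact: measurable_funP.
have PXB : P (X k @^-1` B) \is a fin_num by exact: fin_num_measure.
have fPXB : 0 <= fine (P (X k @^-1` B)) by rewrite fine_ge0.
pose m2 := mscale (NngNum fPXB) P.
have -> : (P A * P (X k @^-1` B) = m2 A)%E.
  by rewrite /m2 /mscale/= fineK// muleC.
rewrite -[LHS]/(mrestr P mXB A).
apply: (g_sigma_algebra_measure_unique cylinders cylinders_measurable
  (fun=> setT)) => //.
- move=> _; exists (fun=> setT) => //.
  by apply/seteqP; split.
- by rewrite bigcup_const//; exists 0%N.
- move=> _ _ [B1 mB1 <-] [B2 mB2 <-].
  exists (fun i => B1 i `&` B2 i); first by move=> i; exact: measurableI.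
  by rewrite -bigcapI.
- move=> _ [B1 mB1 <-]; rewrite /m2 /= /mscale/= /mrestr fineK//.
  pose B' i := if i == k then B else B1 i.
  have mB' i : measurable (B' i) by rewrite /B'; case: ifP.
  have B'J i : i \in J -> B' i = B1 i.
    by rewrite /B' => iJ; case: eqP iJ => // ->; rewrite (negbTE kJ).
  have B'k : B' k = B by rewrite /B' eqxx.
  have := Xind (k |` J)%fset B' mB'.
  rewrite big_fsetU1//= B'k.
  have -> : \bigcap_(i in [set` (k |` J)%fset]) X i @^-1` B' i =
      \bigcap_(i in [set` J]) X i @^-1` B1 i `&` X k @^-1` B.
    apply/seteqP; split => [w H|w [H1 H2] i /=].
    + split=> [i iJ|]; first by rewrite /= -(B'J _ iJ); apply: H; rewrite /= !inE iJ orbT.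
      by rewrite -B'k; apply: H; rewrite /= !inE eqxx.
    + rewrite !inE => /orP[/eqP->|iJ]; first by rewrite B'k.
      by rewrite B'J//; exact: H1.
  move=> ->; congr (_ * _)%E.
  rewrite (Xind J B1 mB1); apply: eq_big_seq => i iJ.
  by rewrite B'J.
- by move=> _; rewrite /= /mrestr setTI ltey_eq fin_num_measure.
Qed.

End independent_sigma_algebra.

(** * Survival events and their measurability with respect to past claims *)

Section survival.
Context d (T : measurableType d) (R : realType) (P : probability T R).
Variables (X : nat -> {RV P >-> R}) (c v : R).
Hypotheses (Xind : mutually_independent X)
  (Xexp : forall i, exponential_with_mean 1 (X i)) (c0 : 0 < c) (v0 : 0 <= v).

Local Notation Z := (surplus c v X).

(** With [v = u + c], [Z k] is the capital just before the claim [X k] is paid, the premium of that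
    period being already collected. *)
Definition survive n : set T := [set w | forall k, (k < n)%N -> X k w <= Z k w].

Lemma surplusS n w : Z n.+1 w = Z n w + c - X n w.
Proof. by rewrite /surplus big_ord_recr/= -natr1; ring. Qed.

Lemma survive0 : survive 0 = setT.
Proof. by apply/seteqP; split. Qed.

Lemma surviveS n : survive n.+1 = survive n `&` [set w | X n w <= Z n w].
Proof.
apply/seteqP; split => [w H|w [H Hn] k] /=.
  by split => [k kn|]; apply: H => //; exact: ltnW.
by rewrite ltnS leq_eqVlt => /predU1P[->//|]; exact: H.
Qed.

(** The last claim left a nonnegative amount, to which a premium is added. This bounds
    [expR (- (g * Z n w))] by 1 on [survive n] when [0 <= g]. *)
Lemma survive_surplus_ge0 n w : survive n w -> 0 <= Z n w.
Proof.
case: n => [_|n]; first by rewrite /surplus big_ord0 mulr0 subr0 addr0.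
move=> /(_ n (ltnSn n)); rewrite surplusS addrAC => XZ.
by rewrite addr_ge0 ?subr_ge0// ltW.
Qed.

Local Notation past n := (cylinders X [fset i in iota 0 n]%fset).

Lemma measurable_fun_surplus_past n k : (k <= n)%N ->
  measurable_fun setT (Z k : g_sigma_algebraType (past n) -> R).
Proof.
move=> kn; apply: measurable_funB; first exact: measurable_cst.
apply: measurable_sum => i; apply: measurable_fun_cylinders.
by rewrite !inE mem_iota/= add0n (leq_trans (ltn_ord i)).
Qed.

Lemma measurable_fun_surplus n : measurable_fun setT (Z n).
Proof.
rewrite (_ : Z n = (Z n : g_sigma_algebraType (past n) -> R) \o id)//.
apply: measurableT_comp; last exact: measurable_fun_id_cylinders.
exact: measurable_fun_surplus_past.
Qed.

Lemma measurable_survive_past n :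
  measurable (survive n : set (g_sigma_algebraType (past n))).
Proof.
rewrite (_ : survive n = \big[setI/setT]_(k < n) [set w | X k w <= Z k w]).
  apply: bigsetI_measurable => k _.
  have := @measurable_fun_ler _ (g_sigma_algebraType (past n)) R setT (X k) (Z k).
  move=> /(_ _ _ measurableT [set true] _); rewrite setTI; apply => //.
  - apply: measurable_fun_cylinders.
    by rewrite !inE mem_iota/= add0n; exact: ltn_ord.
  - by apply: measurable_fun_surplus_past; apply: ltnW; exact: ltn_ord.
elim: n => [|n IH]; first by rewrite survive0 big_ord0.
by rewrite surviveS big_ord_recr IH.
Qed.

Lemma measurable_survive n : measurable (survive n).
Proof.
by apply: sigma_cylinders_measurable; exact: measurable_survive_past.
Qed.

Lemma integrable_survive (g : R) n : 0 <= g ->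
  P.-integrable (survive n) (EFin \o (fun w => expR (- (g * Z n w)))).
Proof.
move=> g0; apply: measurable_bounded_integrable => //.
- exact: measurable_survive.
- by rewrite ltey_eq fin_num_measure//; exact: measurable_survive.
- apply: measurable_funTS; apply: measurableT_comp => //.
  apply: measurableT_comp => //; apply: measurable_funM => //.
  exact: measurable_fun_surplus.
- exists 1; split; first exact: num_real.
  move=> M M1 w /survive_surplus_ge0 Zw.
  rewrite /= ger0_norm ?expR_ge0// (le_trans _ (ltW M1))// -expR0 ler_expR.
  by rewrite oppr_le0 mulr_ge0.
Qed.

(** * Recursion for the exponential moments on survival *)

Definition survival_moment (g : R) n := \int[P]_(w in survive n) expR (- (g * Z n w)).

(* [growth g = E (exp (- g (c - X)))] for a standard exponential claim [X]. *)
Definition growth (g : R) := expR (- (g * c)) / (1 - g).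

Lemma measurable_fun_claim n : measurable_fun setT (X n : T -> measurableTypeR R).
Proof. by move=> _ B mB; exact: measurable_funP. Qed.

(* [R] and [measurableTypeR R], the carrier of [lebesgue_measure], have the
   same measurable sets but different displays, so their measures have
   incompatible types. *)
Definition claim n : {mfun T >-> measurableTypeR R} :=
  HB.pack (X n : T -> measurableTypeR R)
    (isMeasurableFun.Build _ _ _ _ _ (measurable_fun_claim n)).

(** Truncating the claim at [Z n w] costs [expR ((g - 1) * Z n w)], which combines with
    [expR (- (g * Z n w))] to an exponential of parameter 1 whatever [g] is. Hence the same moment
    is subtracted for all [g]. *)
Lemma integral_survive_next (g : R) n w : 0 <= g < 1 -> 0 <= Z n w ->
  (\int[distribution P (claim n)]_(y in `]-oo, Z n w]) (expR (- (g * (Z n w + c - y))))%:E =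
    (growth g * (expR (- (g * Z n w)) - expR (- (1 * Z n w))))%:E)%E.
Proof.
move=> g01 Zw.
under eq_integral.
  move=> y _.
  rewrite (_ : _%:E = (expR (- (g * (Z n w + c))))%:E * (expR (g * y))%:E)%E; last first.
    by rewrite -EFinM -expRD; congr (expR _)%:E; ring.
  over.
rewrite ge0_integralZl//=; last first.
  by apply/measurable_EFinP; apply: measurableT_comp.
have nuE A : measurable A -> distribution P (claim n) A = exponential_prob 1 A.
  by move=> mA; rewrite -[LHS]/(distribution P (X n) A) Xexp// invr1.
rewrite [X in (_ * X)%E](_ : _ = ((1 - expR ((g - 1) * Z n w)) / (1 - g))%:E); last first.
  exact: (@integral_exponential_expR R (distribution P (claim n)) g (Z n w) nuE g01 Zw).
rewrite -EFinM /growth; congr (_%:E); have /andP[_ g1] := g01.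
have -> : expR (- (g * (Z n w + c))) = expR (- (g * c)) * expR (- (g * Z n w)).
  by rewrite -expRD; congr expR; ring.
have -> : expR (- (1 * Z n w)) = expR (- (g * Z n w)) * expR ((g - 1) * Z n w).
  by rewrite -expRD; congr expR; ring.
by field; rewrite subr_eq0 gt_eqF.
Qed.

Lemma survival_momentS (g : R) n : 0 <= g < 1 ->
  survival_moment g n.+1 = growth g * (survival_moment g n - survival_moment 1 n).
Proof.
move=> g01; have /andP[g0 g1] := g01.
rewrite /survival_moment -RintegralB; last 3 first.
- exact: measurable_survive.
- exact: integrable_survive.
- by apply: integrable_survive; exact: ler01.
rewrite -RintegralZl; last 2 first.
- exact: measurable_survive.
- rewrite (_ : EFin \o _ = (EFin \o (fun w => expR (- (g * Z n w)))) \-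
      (EFin \o (fun w => expR (- (1 * Z n w)))))%E; last first.
    by apply/funext => w /=; rewrite EFinB.
  apply: integrableB; first exact: measurable_survive.
    exact: integrable_survive.
  by apply: integrable_survive; exact: ler01.
rewrite /Rintegral; congr fine.
(* The past is summarised by the identity map onto [T] with its coarser
   sigma-algebra, which is independent of the next claim. *)
pose T1 := g_sigma_algebraType (past n).
have mid : measurable_fun setT (id : T -> T1) by exact: measurable_fun_id_cylinders.
pose Z1 : {mfun T >-> T1} := HB.pack (id : T -> T1) (isMeasurableFun.Build _ _ _ _ _ mid).
(* [A] is survival up to time [n.+1] and [F] the integrand on it, written with the past and the next
   claim as separate coordinates. *)
pose A := [set z : T1 * measurableTypeR R | survive n z.1 /\ z.2 <= Z n z.1].
pose F (z : T1 * measurableTypeR R) := (\1_A z * expR (- (g * (Z n z.1 + c - z.2))))%:E.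
have mZ : measurable_fun setT (fun z : T1 * measurableTypeR R => Z n z.1).
  apply: measurableT_comp; last exact: measurable_fst.
  exact: measurable_fun_surplus_past.
have msnd : measurable_fun setT (fun z : T1 * measurableTypeR R => z.2 : R).
  by move=> mD B mB; exact: measurable_snd.
have mA : measurable A.
  apply: measurableI.
    rewrite -[X in measurable X]setTI; apply: measurable_fst => //.
    exact: measurable_survive_past.
  have := @measurable_fun_ler _ _ R setT _ _ msnd mZ.
  by move=> /(_ measurableT [set true] _); rewrite setTI; apply.
have mF : measurable_fun setT F.
  apply/measurable_EFinP; apply: measurable_funM; first exact: measurable_indic.
  apply: measurableT_comp => //; apply: measurableT_comp => //.
  apply: measurable_funM => //; apply: measurable_funB => //.
  exact: measurable_funD.
have F0 z : (0 <= F z)%E by rewrite lee_fin mulr_ge0 ?expR_ge0// indicE.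
have := @ge0_integral_independent _ _ _ T T1 (measurableTypeR R) R P Z1 (claim n) F.
move=> /(_ _ mF F0) FE.
rewrite [LHS]integral_mkcond [RHS]integral_mkcond.
transitivity (\int[P]_w F (Z1 w, X n w))%E.
  apply: eq_integral => w _; rewrite patchE /F indicE surviveS surplusS.
  rewrite (_ : _ \in A = (w \in survive n `&` [set w | X n w <= Z n w])) //.
  by case: ifPn => _; rewrite ?mul1r ?mul0r.
rewrite FE; last first.
  move=> B C mB mC.
  apply: (@sigma_cylinders_independent _ _ _ _ _ [fset i in iota 0 n]%fset) => //.
  by rewrite !inE mem_iota/= add0n ltnn.
apply: eq_integral => w _; rewrite patchE; case: ifPn => [|] sw.
  rewrite inE in sw.
  rewrite -integral_survive_next//; last exact: survive_surplus_ge0.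
  rewrite [RHS]integral_mkcond; apply: eq_integral => y _.
  rewrite patchE /F indicE.
  rewrite (_ : _ \in A = (y \in `]-oo, Z n w]%classic)).
    by case: ifPn => _; rewrite ?mul1r ?mul0r.
  apply/idP/idP; rewrite !inE/= in_itv/=; first by case.
  by move=> yZ; split.
apply: integral0_eq => y _; rewrite /F indicE memNset ?mul0r// => -[].
by rewrite -[_ n _]in_setE (negbTE sw).
Qed.

Lemma survival_moment_init (g : R) : survival_moment g 0 = expR (- (g * v)).
Proof.
rewrite /survival_moment survive0.
rewrite (@eq_Rintegral _ _ _ P _ (fun=> expR (- (g * v)))); last first.
  by move=> w _; rewrite /surplus big_ord0 mulr0 addr0 subr0.
by rewrite Rintegral_cst// [X in fine X](probability_setT P) mulr1.
Qed.

Lemma survival_moment_ge0 (g : R) n : 0 <= survival_moment g n.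
Proof. by apply: Rintegral_ge0 => w _; exact: expR_ge0. Qed.

Lemma le_survival_moment (g g' : R) n : 0 <= g <= g' ->
  survival_moment g' n <= survival_moment g n.
Proof.
move=> /andP[g0 gg']; apply: le_Rintegral.
- exact: measurable_survive.
- by apply: integrable_survive; exact: le_trans gg'.
- exact: integrable_survive.
- move=> w /survive_surplus_ge0 Zw.
  by rewrite ler_expR lerN2 ler_wpM2r.
Qed.

Lemma survive_probability n : P (survive n) = (survival_moment 0 n)%:E.
Proof.
rewrite /survival_moment (@eq_Rintegral _ _ _ P _ (fun=> 1)); last first.
  by move=> w _; rewrite mul0r oppr0 expR0.
rewrite Rintegral_cst; last exact: measurable_survive.
by rewrite mul1r fineK// fin_num_measure//; exact: measurable_survive.
Qed.

Lemma survival_moment_martingale (r : R) n : 0 <= r < 1 -> growth r = 1 ->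
  survival_moment 0 n = survival_moment r n + (1 - expR (- (r * v))).
Proof.
move=> r01 Gr; elim: n => [|n IH].
  by rewrite !survival_moment_init mul0r oppr0 expR0; ring.
rewrite !survival_momentS ?lexx ?ltr01// Gr IH /growth mul0r oppr0 expR0 addr0 divr1.
by ring.
Qed.

(** Dropping the subtracted nonnegative moment from the recursion leaves a geometric bound. *)
Lemma survival_moment_decay (g : R) n : 0 <= g < 1 ->
  survival_moment g n <= growth g ^+ n.
Proof.
move=> g01; have /andP[g0 g1] := g01.
have G0 : 0 <= growth g by rewrite divr_ge0 ?expR_ge0// subr_ge0 ltW.
elim: n => [|n IH].
  by rewrite survival_moment_init expr0 -expR0 ler_expR oppr_le0 mulr_ge0.
rewrite survival_momentS// exprS ler_wpM2l// (le_trans _ IH)//.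
by rewrite gerBl survival_moment_ge0.
Qed.

(** The events [survive n] decrease, so their probabilities tend to that of the intersection; [g]
    squeezes [survival_moment r n] to 0. *)
Lemma survival_probability (g r : R) : 0 <= g <= r -> r < 1 ->
  growth g < 1 -> growth r = 1 ->
  P (\bigcap_n survive n) = (1 - expR (- (r * v)))%:E.
Proof.
move=> /andP[g0 gr] r1 Gg Gr.
have g1 : g < 1 by exact: le_lt_trans r1.
have r0 : 0 <= r by exact: le_trans gr.
have G0 : 0 <= growth g by rewrite divr_ge0 ?expR_ge0// subr_ge0 ltW.
have lim0 : survival_moment r n @[n --> \oo] --> 0.
  have limG : growth g ^+ n @[n --> \oo] --> 0 by apply: cvg_expr; rewrite ger0_norm.
  apply: (squeeze_cvgr _ (cvg_cst 0) limG).
  near=> n; rewrite survival_moment_ge0/=.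
  apply: le_trans (survival_moment_decay _ _); last by rewrite g0.
  by apply: le_survival_moment; rewrite g0.
have mI : measurable (\bigcap_n survive n).
  by apply: bigcapT_measurable => n; exact: measurable_survive.
have noninc : nonincreasing_seq survive.
  by move=> m n mn; apply/subsetPset => w H k km; apply: H; exact: leq_trans mn.
have := nonincreasing_cvg_mu (mu := P) _ measurable_survive mI noninc.
move=> /(_ (le_lt_trans (probability_le1 P (measurable_survive 0)) (ltry _))).
move=> /cvg_lim <- //; apply/cvg_lim => //.
rewrite (_ : P \o survive = fun n => (survival_moment r n + (1 - expR (- (r * v))))%:E).
  apply: cvg_EFin; first by near=> n.
  by rewrite -[X in _ --> X]add0r; apply: cvgD => //; exact: cvg_cst.
apply/funext => n /=; rewrite survive_probability.
by rewrite -survival_moment_martingale ?r0.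
Unshelve. all: by end_near. Qed.

(** With initial capital [v - c], the surplus at time [n.+1] is [Z n w - X n w]: the shift by one
    premium matches the shift of the index. *)
Lemma ruin_eventE :
  [set w | exists2 n, (0 < n)%N & surplus c (v - c) X n w < 0] =
  ~` \bigcap_n survive n.
Proof.
have E n w : surplus c (v - c) X n.+1 w = Z n w - X n w.
  by rewrite /surplus big_ord_recr/= -natr1; ring.
apply/seteqP; split => w /=.
  move=> [[//|n] _]; rewrite E subr_lt0 => XZ H.
  by have := H n.+1 I n (ltnSn n); rewrite leNgt XZ.
apply: contra_notP => H n _ k kn; rewrite leNgt; apply/negP => XZ; apply: H.
by exists k.+1 => //; rewrite E subr_lt0.
Qed.

Lemma measurable_ruin :
  measurable [set w | exists2 n, (0 < n)%N & surplus c (v - c) X n w < 0].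
Proof.
rewrite ruin_eventE; apply: measurableC.
by apply: bigcapT_measurable => n; exact: measurable_survive.
Qed.

Lemma ruin_probabilityE (g r : R) : 0 <= g <= r -> r < 1 ->
  growth g < 1 -> growth r = 1 ->
  ruin_probability c X (v - c) = (expR (- (r * v)))%:E.
Proof.
move=> gr r1 Gg Gr; rewrite /ruin_probability ruin_eventE probability_setC.
  by rewrite (survival_probability gr)// -EFinB; congr (_%:E); ring.
by apply: bigcapT_measurable => n; exact: measurable_survive.
Qed.

End survival.

(** * The function [tfun] and the adjustment coefficient [1 - tfun c / c] *)

Section tfun_properties.
Variable R : realType.
Implicit Types c x y : R.

(** After division by [expR (- y)] this is [y < x * expR (y - x)], which follows from
    [1 + s < expR s] at [s = y - x] and [0 <= (x - 1) * (y - x)]. *)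
Lemma gfun_decr x y : 1 <= x -> x < y -> gfun y < gfun x.
Proof.
move=> x1 xy; have x0 : 0 < x by exact: lt_le_trans x1.
rewrite /gfun (_ : - x = - y + (y - x)); last by ring.
rewrite expRD mulrCA [ltLHS]mulrC ltr_pM2l ?expR_gt0//.
have yx : y - x != 0 by rewrite subr_eq0 gt_eqF.
apply: (@le_lt_trans _ _ (x * (1 + (y - x)))); last first.
  by rewrite ltr_pM2l// expR_gt1Dx.
rewrite -subr_ge0 (_ : _ - _ = (x - 1) * (y - x)); last by ring.
by rewrite mulr_ge0// subr_ge0// ltW.
Qed.

Lemma gfun_fiber_expR c x : 0 < c -> gfun x = gfun c -> expR (x - c) = x / c.
Proof.
move=> c0; rewrite /gfun expRD => xc.
apply: (mulIf (lt0r_neq0 c0)); rewrite divfK ?lt0r_neq0//.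
rewrite -mulrA [X in _ * X]mulrC -xc mulrCA -expRD subrr expR0 mulr1 //.
Qed.

Lemma tfun_gt0 c : 0 < c -> 0 < tfun c.
Proof.
move=> c0; have [/andP[t0 _] tc _] := tfun_spec (ltW c0).
rewrite lt_neqAle t0 andbT eq_sym; apply/eqP => t00.
move: tc; rewrite t00 /gfun mul0r => /esym/eqP.
by rewrite mulf_eq0 !gt_eqF ?expR_gt0.
Qed.

Lemma tfun_le1 c : 0 <= c -> tfun c <= 1.
Proof. by move=> /tfun_spec[/andP[]]. Qed.

Lemma expR_tfun c : 0 < c -> expR (tfun c - c) = tfun c / c.
Proof.
by move=> c0; apply: gfun_fiber_expR => //; have [] := tfun_spec (ltW c0).
Qed.

(** Strict decrease of [gfun] beyond 1 forbids [1 < x], and on the unit interval the solution is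
    unique. *)
Lemma eq_tfun c x : 0 <= x < c -> gfun x = gfun c -> x = tfun c.
Proof.
move=> /andP[x0 xc] gxc; have c0 : 0 <= c by rewrite (le_trans x0)// ltW.
have [_ _ tU] := tfun_spec c0; apply: tU => //; rewrite x0/= leNgt.
by apply/negP => x1; have := gfun_decr (ltW x1) xc; rewrite gxc ltxx.
Qed.

Lemma adjustment_bounds c : 1 < c ->
  [/\ 0 < 1 - c^-1, 1 - c^-1 <= 1 - tfun c / c & 1 - tfun c / c < 1].
Proof.
move=> c1; have c0 : 0 < c by exact: lt_trans c1.
split; first by rewrite subr_gt0 invf_lt1.
  by rewrite lerD2l lerN2 ler_pdivrMr// mulVf ?lt0r_neq0// tfun_le1 ?(ltW c0).
by rewrite gtrBl divr_gt0// tfun_gt0.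
Qed.

Lemma growth_adjustment c : 0 < c -> growth c (1 - tfun c / c) = 1.
Proof.
move=> c0; rewrite /growth.
rewrite (_ : - _ = tfun c - c); last by field; rewrite lt0r_neq0.
rewrite expR_tfun// (_ : 1 - _ = tfun c / c); last by ring.
by rewrite divff// mulf_neq0 ?invr_neq0 ?lt0r_neq0 ?tfun_gt0.
Qed.

(** The value is [c * expR (- (c - 1))], and [1 + s < expR s] at [s = c - 1]. *)
Lemma growth_lt1 c : 1 < c -> growth c (1 - c^-1) < 1.
Proof.
move=> c1; have c0 : 0 < c by exact: lt_trans c1.
rewrite /growth (_ : - _ = - (c - 1)); last by field; rewrite lt0r_neq0.
rewrite (_ : 1 - _ = c^-1); last by ring.
rewrite invrK expRN mulrC ltr_pdivrMr ?expR_gt0// mul1r.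
rewrite (_ : c = 1 + (c - 1)); last by ring.
by rewrite addrAC subrr add0r expR_gt1Dx// subr_eq0 gt_eqF.
Qed.

End tfun_properties.

(** * Closed form of the ruin probability and the minimum capital *)

Theorem theorem3 (R : realType) (d : measure_display) (T : measurableType d)
    (P : probability T R) (X : nat -> {RV P >-> R}) (alpha theta : R)
    (X_indep : mutually_independent X)
    (X_exp : forall i, exponential_with_mean 1 (X i))
    (alpha01 : 0 < alpha < 1) (theta_gt0 : 0 < theta) :
  let c := 1 + theta in
  let psi := ruin_probability c X in
  (forall u : R,
     psi u = (if - c < u then tfun c / c * expR (- (u * (1 - tfun c / c))) else 1)%:E)
  /\
  (exists u0 : R,
     is_minimum [set u | (psi u <= alpha%:E)%E] u0 /\
     unique (fun u => - (1 + theta) < u /\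
       (1 + theta + u) * (1 - alpha `^ ((1 + theta) / (1 + theta + u)))
         = - ln alpha) u0).
Proof.
move=> c psi.
have c1 : 1 < c by rewrite ltrDl.
have c0 : 0 < c by exact: lt_trans c1.
have cN0 : c != 0 by exact: lt0r_neq0.
have /andP[a0 a1] := alpha01.
have lna : ln alpha < 0 by rewrite ln_lt0// a0.
pose r := 1 - tfun c / c.
have [g0 gr r1] := adjustment_bounds c1; rewrite -/r in gr r1.
have r0 : 0 < r by exact: lt_le_trans gr.
(* This absorbs the prefactor [tfun c / c = 1 - r] into the exponent. *)
have Er : expR (- (r * c)) = 1 - r.
  rewrite (_ : - _ = tfun c - c); last by rewrite /r; field.
  by rewrite expR_tfun// /r; ring.
have psiE u : - c <= u -> psi u = (expR (- (r * (c + u))))%:E.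
  move=> cu; have cu0 : 0 <= c + u by rewrite -lerBlDl sub0r.
  rewrite -(ruin_probabilityE (c := c) X_indep X_exp c0 cu0 (g := 1 - c^-1)) ?(ltW g0)//.
  - by rewrite /psi; congr ruin_probability; ring.
  - exact: growth_lt1.
  - exact: growth_adjustment.
(* Lowering the capital enlarges the ruin event, and the formula already gives 1 at [- c]. *)
have psi1 u : u <= - c -> psi u = 1%:E.
  move=> uc; apply/eqP; rewrite eq_le; apply/andP; split.
    by apply: probability_le1; rewrite -(addrK c u); exact: measurable_ruin.
  have <- : psi (- c) = 1%:E by rewrite psiE// subrr mulr0 oppr0 expR0.
  apply: le_measure; rewrite ?inE.
  - by rewrite -[- c](addrK c); exact: measurable_ruin.
  - by rewrite -[u](addrK c); exact: measurable_ruin.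
  - move=> w /= [n n0 H]; exists n => //; apply: le_lt_trans H.
    by rewrite /surplus !lerD2r.
split=> [u|].
  case: ifPn => cu; last by rewrite psi1// leNgt.
  rewrite psiE ?(ltW cu)// -/r (_ : tfun c / c = 1 - r); last by rewrite /r; ring.
  by rewrite -Er -expRD; congr (expR _)%:E; ring.
(* The witness solves [expR (- (r * (c + u))) = alpha]. *)
exists (- ln alpha / r - c); set u0 := _ - c.
have cu0 : c + u0 = - ln alpha / r by rewrite /u0; ring.
have u0c : - c < u0 by rewrite ltrBrDl subrr divr_gt0// oppr_gt0.
have rN0 : r != 0 by exact: lt0r_neq0.
split; [split => [/=|u /=]|split => [|u [cu]]].
- rewrite psiE ?(ltW u0c)// cu0 lee_fin [r * _]mulrC divfK// opprK.
  by rewrite lnK// posrE.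
- case: (leP u (- c)) => cu; first by rewrite psi1// lee_fin leNgt a1.
  rewrite psiE ?(ltW cu)// lee_fin -[leRHS]lnK ?posrE// ler_expR => H.
  by rewrite /u0 lerBlDl ler_pdivrMr// mulrC lerNl.
- split=> //; rewrite -/c cu0 /powR gt_eqF//.
  rewrite (_ : _ / _ * ln alpha = - (r * c)); last first.
    by field; rewrite rN0 lt_eqF.
  by rewrite Er; field.
- rewrite -/c => Eu.
  have s0 : 0 < c + u by rewrite -ltrBlDl sub0r.
  have sN0 : c + u != 0 by exact: lt0r_neq0.
  (* The power of [alpha] in the equation is [expR (x - c)], so the equation becomes
     [expR (x - c) = x / c]. *)
  pose x := c + c * ln alpha / (c + u).
  have Ex : expR (x - c) = x / c.
    move: Eu; rewrite /powR gt_eqF//.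
    rewrite (_ : _ / _ * ln alpha = x - c); last by rewrite /x; ring.
    set e := expR _ => Eu.
    rewrite /x (_ : ln alpha = - ((c + u) * (1 - e))); last by rewrite Eu opprK.
    by field; rewrite cN0.
  have xE : x = c * expR (x - c) by rewrite Ex; field.
  (* Since [ln alpha < 0], [x < c], which excludes the trivial solution [x = c]. *)
  have xt : x = tfun c.
    apply: eq_tfun; last by rewrite /gfun {1}xE -mulrA -expRD; congr (_ * expR _); ring.
    rewrite {1}xE mulr_ge0 ?expR_ge0 ?(ltW c0)//= /x gtrDl.
    by rewrite pmulr_llt0 ?invr_gt0// pmulr_rlt0.
  have rE : r = - ln alpha / (c + u) by rewrite /r -xt /x; field; rewrite sN0 cN0.
  by rewrite /u0 rE; field; rewrite sN0 lt_eqF.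
Qed.
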